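(* Let $\Sigma$ be an alphabet and let $I=w^{-1}\Sigma^*w$ for some $w\in\Sigma^*$. The syntactic complexity of $I$ is equal to $$\sigma(I)=|w|+1+|\mathrm{Pref}(w)|+|\mathrm{Fact}(w)|+|\mathrm{Suff}(w)|-|\mathrm{Pref}_{syn}(w)|.$$
   Context: $w^{-1}\Sigma^*w=\{v\in\Sigma^*: wv\in\Sigma^*w\}$, and $|w|$ is the length of $w$. For a regular language $L\subseteq\Sigma^*$ the syntactic (Myhill) congruence is: $u\approx_L v$ iff for all $x,y\in\Sigma^*$, $xuy\in L\Leftrightarrow xvy\in L$. The syntactic semigroup of $L$ is $\Sigma^+/\approx_L$, and the syntactic complexity $\sigma(L)$ is its cardinality. A word $u$ is a prefix of $w$ if $w=uu_2$ for some $u_2\in\Sigma^*$, and a suffix of $w$ if $w=u_1u$ for some $u_1\in\Sigma^*$. A word $u\in\Sigma^+$ is an inner factor of $w$ if $w=xuy$ for some $x,y\in\Sigma^+$. $\mathrm{Fact}(w)$ is the set of different inner factors of $w$. $\mathrm{Suff}(w)$ is the set of proper non-empty suffixes of $w$ which do not appear in $w$ as inner factors. $\mathrm{Pref}(w)$ is the set of proper non-empty prefixes of $w$ which do not appear in $w$ as suffixes or inner factors. $\mathrm{Pref}_{syn}(w)$ is the set of prefixes of $w$ synchronizing the automaton $\mathscr{A}_w$ defined next, i.e. the prefixes of $w$ that are reset words for $\mathscr{A}_w$. For words $u,w$ let $u\wedge_s w$ be the maximal suffix of $u$ that appears in $w$ as a prefix. $\mathscr{A}_w$ is the automaton whose states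 are the $|w|+1$ prefixes of $w$ (including the empty word and $w$), with transition function $\xi(q,a)=(qa)\wedge_s w$ for each prefix $q$ of $w$ and each $a\in\Sigma$ (extended to words), and with $w$ as initial and only final state. A word $u$ is reset for $\mathscr{A}_w$ if $\xi(q,u)=\xi(q',u)$ for all states $q,q'$.
   Formalization: The alphabet is assumed to have at least two letters, and Pref_syn(w) contains only proper prefixes of w; as written the formula fails, e.g. for Σ={a,b}, w=a (σ=2, formula gives 1), and for one letter with w=a^n, n≥2. *)

(* Defs.v *)
From HB Require Import structures.
From mathcomp Require Import all_boot finmap.
From mathcomp Require Import mathcomp_extra boolp classical_sets functions cardinality.

Set Implicit Arguments.
Unset Strict Implicit.
Unset Printing Implicit Defensive.

Local Open Scope classical_set_scope.

Section Languages.
Variable Sigma : finType.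
Implicit Types (L : set (seq Sigma)) (u v w : seq Sigma).

Definition left_ideal_of w : set (seq Sigma) := [set u | suffix w u].

Definition left_quotient w L : set (seq Sigma) := [set v | L (w ++ v)].

Definition syntactic_congruence L u v : Prop :=
  forall x y, L (x ++ u ++ y) <-> L (x ++ v ++ y).

(* The underlying set of the quotient of the nonempty words: each element is
   a congruence class, itself a set of nonempty words. *)
Definition syntactic_semigroup L : set (set (seq Sigma)) :=
  [set [set v | v != [::] /\ syntactic_congruence L u v] |
     u in [set u | u != [::]]].

Definition has_syntactic_complexity L (n : nat) : Prop :=
  (syntactic_semigroup L #= `I_n)%card.

Definition inner_factor u w : Prop :=
  u != [::] /\ exists x y, [/\ x != [::], y != [::] & w = x ++ u ++ y].

Definition Fact w : set (seq Sigma) := [set u | inner_factor u w].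

Definition Suff w : set (seq Sigma) :=
  [set u | [/\ u != [::], u != w, suffix u w & ~ inner_factor u w]].

Definition Pref w : set (seq Sigma) :=
  [set u | [/\ u != [::], u != w, prefix u w, ~ suffix u w
             & ~ inner_factor u w]].

End Languages.

Section Automata.
Variable Sigma : finType.

Record dfa := DFA {
  state : Type;
  initial : state;
  final : set state;
  step : state -> Sigma -> state }.

Definition run (A : dfa) (q : state A) (u : seq Sigma) : state A :=
  foldl (@step A) q u.

Definition reset_word (A : dfa) (u : seq Sigma) : Prop :=
  forall q q' : state A, run q u = run q' u.

(* Drops as few letters of u as needed to reach a prefix of w. *)
Fixpoint suffix_meet (u w : seq Sigma) : seq Sigma :=
  if prefix u w then u else if u is _ :: u' then suffix_meet u' w else [::].

Lemma suffix_meet_prefix u w : prefix (suffix_meet u w) w.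
Proof.
by elim: u => [|a u IHu] /=; [case: ifP; rewrite prefix0s | case: ifP].
Qed.

Lemma suffix_meet_suffix u w : suffix (suffix_meet u w) u.
Proof.
elim: u => [|a u IHu] /=; first by case: ifP.
by case: ifP => _; [exact: suffix_refl | exact: (suffix_trans IHu (suffix_cons _ _))].
Qed.

Lemma suffix_meet_max u w v :
  suffix v u -> prefix v w -> size v <= size (suffix_meet u w).
Proof.
elim: u => [|a u IHu] /= vu vw; first by move: vu; rewrite suffixs0 => /eqP->.
case: ifP => uw; first exact: size_suffix.
apply: IHu => //; case/suffixP: vu => -[|b s] /= e; last first.
  by case: e => _ ->; rewrite suffix_suffix.
by rewrite e vw in uw.
Qed.

Definition prefix_automaton (w : seq Sigma) : dfa :=
  let top := exist (fun q => prefix q w) w (prefix_refl w) in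
  {| state := {q : seq Sigma | prefix q w};
     initial := top;
     final := [set top];
     step := fun q a =>
       exist (fun q => prefix q w) (suffix_meet (rcons (sval q) a) w)
         (suffix_meet_prefix (rcons (sval q) a) w) |}.

(* Only proper prefixes are taken, as in [Pref]. The word w itself always
   resets its prefix automaton, so admitting it would lower the value of
   |w| + 1 + |Pref| + |Fact| + |Suff| - |Pref_syn| by one. *)
Definition Pref_syn (w : seq Sigma) : set (seq Sigma) :=
  [set u | [/\ u != w, prefix u w & reset_word (prefix_automaton w) u]].

(* [fset_set A] is empty when A is infinite; the four sets above consist of
   factors of w, hence are finite. *)
Definition card_words (A : set (seq Sigma)) : nat := #|` fset_set A|%fset.

End Automata.

(* Main.v *)
(** The class of a word u in the syntactic semigroup is determined by its action
    q |-> q u /\_s w on the prefixes q of w.  A nonempty word acts as a constant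
    exactly when it does not occur in w at a positive position, and every prefix
    of w is the value of such a constant, which gives |w| + 1 classes.  Two words
    occurring at positive positions act alike only if they are equal: if u occurs
    in w after q, then u sends q to q u, which has length |q| + |u|.  This gives
    |Fact w| + |Suff w| further classes.  By the same criterion Pref_syn w and
    Pref w coincide, so these two terms of the formula cancel. *)
Require Import Defs.
From mathcomp Require Import all_boot finmap.
From mathcomp Require Import mathcomp_extra boolp classical_sets functions cardinality.
From mathcomp Require Import zify.

Set Implicit Arguments.
Unset Strict Implicit.
Unset Printing Implicit Defensive.

Local Open Scope classical_set_scope.

(** * Prefixes and suffixes of a common word *)

Section SeqComplements.
Variable T : eqType.
Implicit Types s t u : seq T.

Lemma suffix_leq_size s t u :
  suffix s u -> suffix t u -> size s <= size t -> suffix s t.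
Proof.
move=> /suffixP[x ->] /suffixP[y e] le_st.
have le_xy : size y <= size x by move/(congr1 size): e; rewrite !size_cat; lia.
have /(congr1 (drop (size y))) := e; rewrite drop_cat drop_size_cat //.
case: ltnP => [_ <-|le_yx]; first exact: suffix_suffix.
by rewrite (_ : size y - size x = 0) ?drop0 => [->|]; [exact: suffix_refl | lia].
Qed.

Lemma suffix_eq_size s t u :
  suffix s u -> suffix t u -> size s = size t -> s = t.
Proof. by rewrite !suffixE => /eqP es /eqP et e; rewrite -[LHS]es e. Qed.

Lemma prefix_eq_size s t u :
  prefix s u -> prefix t u -> size s = size t -> s = t.
Proof. by rewrite !prefixE => /eqP es /eqP et e; rewrite -[LHS]es e. Qed.

(** A nonempty suffix of a power of [b] begins with [b]. This is what lets a block of [b] erase the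
    past of the automaton. *)
Lemma prefix_suffix_nseq (b : T) s n :
  (forall t, ~~ prefix (b :: t) s) ->
  forall t, prefix t s -> suffix t (nseq n b) -> t = [::].
Proof.
move=> nb [|c t] // ts tb.
have : c \in nseq n b by apply: (mem_infix (suffixW tb)); rewrite mem_head.
by rewrite mem_nseq => /andP[_ /eqP c_b]; rewrite c_b (negbTE (nb t)) in ts.
Qed.

End SeqComplements.

(** The bound on the alphabet enters here: one letter may be lost to the head of [s], another must
    remain. *)
Lemma exists_non_first_letter (T : finType) (s : seq T) :
  1 < #|T| -> exists b, forall t, ~~ prefix (b :: t) s.
Proof.
move=> /card_gt1P[b [c [_ _ neq_bc]]]; case: s => [|a s]; first by exists b.
have [eq_ba|neq_ba] := eqVneq b a; [exists c|exists b] => t /=.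
  by rewrite -eq_ba eq_sym (negbTE neq_bc).
by rewrite (negbTE neq_ba).
Qed.

(** * Cardinalities of finite sets of words *)

Section WordCardinality.
Variable Sigma : finType.
Implicit Types A B : set (seq Sigma).

Lemma card_wordsU A B : finite_set A -> finite_set B ->
  (forall u, A u -> ~ B u) ->
  card_words (A `|` B) = card_words A + card_words B.
Proof.
move=> finA finB disjAB; rewrite /card_words fset_setU // -cardfsUI.
rewrite -fset_setI // (_ : A `&` B = set0) ?fset_set0 ?cardfs0 ?addn0 //.
by rewrite predeqE => u; split=> // -[/disjAB].
Qed.

Lemma card_eq_words A : finite_set A -> (A #= `I_(card_words A))%card.
Proof. by move=> finA; rewrite -{1}(fset_setK finA); apply/card_eq_fsetP. Qed.

Lemma finite_infix (w : seq Sigma) : finite_set [set u | infix u w].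
Proof.
pose s := [seq take j (drop i w) | i <- iota 0 (size w).+1, j <- iota 0 (size w).+1].
apply: (@sub_finite_set _ _ [set` s]); last exact: finite_seq.
move=> u /= /infixP[x [y ew]]; apply/allpairsP; exists (size x, size u).
rewrite !mem_iota /= {3}ew drop_size_cat // take_size_cat //.
by split=> //; rewrite ew !size_cat; lia.
Qed.

End WordCardinality.

(** * Words acting on the prefixes of [w] *)

Section SuffixMeet.
Variables (Sigma : finType) (w : seq Sigma).
Implicit Types p q s t u v x y : seq Sigma.

Lemma suffix_meetP s u :
  suffix s u -> prefix s w ->
  (forall t, suffix t u -> prefix t w -> size t <= size s) ->
  suffix_meet u w = s.
Proof.
move=> su sw smax; have mu := suffix_meet_suffix u w.
apply: (suffix_eq_size mu su); apply/eqP; rewrite eqn_leq suffix_meet_max //.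
by rewrite smax // suffix_meet_prefix.
Qed.

Lemma suffix_meet_id q : prefix q w -> suffix_meet q w = q.
Proof.
by move=> qw; apply: suffix_meetP; [exact: suffix_refl| |move=> t /size_suffix].
Qed.

(** A suffix of [x ++ y] longer than [y] that is a prefix of [w] has the form [t' ++ y], with [t'] a
    suffix of [x] and a prefix of [w]; so [suffix_meet x w] retains all that reading [y] can use. *)
Lemma suffix_meet_catl x y :
  suffix_meet (suffix_meet x w ++ y) w = suffix_meet (x ++ y) w.
Proof.
apply: esym; apply: suffix_meetP (suffix_meet_prefix _ _) _.
  apply: suffix_trans (suffix_meet_suffix _ _) _.
  by rewrite suffix_catl // eqxx suffix_meet_suffix.
move=> t txy tw; apply: suffix_meet_max => //.
have [le_ty|lt_yt] := leqP (size t) (size y).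
  apply: suffix_trans (suffix_suffix _ _).
  exact: suffix_leq_size txy (suffix_suffix _ _) le_ty.
have := suffix_leq_size (suffix_suffix x y) txy (ltnW lt_yt).
case/suffixP=> t' def_t; move: txy tw; rewrite def_t !suffix_catl // eqxx /=.
move=> t'x /catl_prefix t'w.
by apply: suffix_leq_size t'x (suffix_meet_suffix _ _) (suffix_meet_max t'x t'w).
Qed.

Lemma sval_run (q : state (prefix_automaton w)) u :
  sval (run q u) = suffix_meet (sval q ++ u) w.
Proof.
elim: u q => [|a u IHu] q /=; first by rewrite cats0 suffix_meet_id //; case: q.
by rewrite /run /= -/(run _ _) IHu /= suffix_meet_catl cat_rcons.
Qed.

Lemma left_quotientE v :
  left_quotient w (left_ideal_of w) v <-> suffix_meet (w ++ v) w = w.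
Proof.
rewrite /left_quotient /left_ideal_of /=; split=> [wv|e].
  by apply: suffix_meetP => [//||t _ /size_prefix //]; exact: prefix_refl.
by rewrite -{1}e suffix_meet_suffix.
Qed.

(** Unlike in [inner_factor], [y] may be empty, so an occurrence at the end of [w] counts; one at
    position 0 does not. *)
Definition occurs_later u := u != [::] /\
  exists x y, x != [::] /\ w = x ++ u ++ y.

Lemma Fact_Suff_later : Fact w `|` Suff w = occurs_later.
Proof.
rewrite predeqE => u; split=> [[[u0 [x [y [x0 _ ew]]]]|[u0 uw /suffixP[x ew] _]]|].
- by split=> //; exists x, y.
- split=> //; exists x, [::]; rewrite cats0; split=> //.
  by apply: contra_neq uw => x0; rewrite ew x0.
- case=> u0 [x [y [x0 ew]]]; have [Fu|nFu] := pselect (inner_factor u w); first by left.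
  right; split=> //.
    apply/eqP => /(congr1 size); rewrite ew !size_cat.
    by rewrite -size_eq0 -lt0n in x0; lia.
  have [y0|y0] := eqVneq y [::]; first by rewrite ew y0 cats0 suffix_suffix.
  by case: nFu; split=> //; exists x, y.
Qed.

Lemma occurs_later_size u : occurs_later u -> size u < size w.
Proof.
by case=> u0 [[|c x] [y [// _ ->]]]; rewrite /= !size_cat; lia.
Qed.

(** A suffix of [q ++ u] longer than [u] that is a prefix of [w] would place [u] in [w] after a
    nonempty word, so no letter of [q] survives. *)
Lemma suffix_meet_later q u : u != [::] -> ~ occurs_later u ->
  suffix_meet (q ++ u) w = suffix_meet u w.
Proof.
move=> u0 nu; apply: suffix_meetP (suffix_meet_prefix _ _) _ => [|t tqu tw].
  exact: suffix_trans (suffix_meet_suffix _ _) (suffix_suffix _ _).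
have [le_tu|lt_ut] := leqP (size t) (size u).
  apply: suffix_meet_max => //.
  exact: suffix_leq_size tqu (suffix_suffix _ _) le_tu.
have /suffixP[x def_t] := suffix_leq_size (suffix_suffix q u) tqu (ltnW lt_ut).
case: nu; split=> //; case/prefixP: tw => y ->; exists x, y.
rewrite def_t catA; split=> //; apply: contraL lt_ut => /eqP x0.
by rewrite def_t x0 ltnn.
Qed.

Lemma occurs_laterE u : occurs_later u ->
  exists2 q, prefix q w & suffix_meet (q ++ u) w = q ++ u /\ q != [::].
Proof.
case=> u0 [x [y [x0 ew]]]; exists x; first by rewrite ew prefix_prefix.
by split=> //; apply: suffix_meet_id; rewrite ew catA prefix_prefix.
Qed.

Lemma size_suffix_meet u v : size (suffix_meet u v) <= size u.
Proof. exact: size_suffix (suffix_meet_suffix _ _). Qed.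

(** Reading [u] from a nonempty [q] that precedes it in [w] gives a word longer than [u], out of
    reach from the empty prefix. *)
Lemma occurs_later_moves u : occurs_later u ->
  exists2 q, prefix q w & suffix_meet (q ++ u) w <> suffix_meet u w.
Proof.
case/occurs_laterE=> -[|c q] qw [e // _]; exists (c :: q) => // /(congr1 size).
by have := size_suffix_meet u w; rewrite e size_cat /=; lia.
Qed.

Definition same_action u v :=
  forall q, prefix q w -> suffix_meet (q ++ u) w = suffix_meet (q ++ v) w.

(** Let [v] be at least as long as [u], and [q] precede [v] in [w]. Nothing is dropped from
    [q ++ v], which is then a suffix of [q ++ u]; this forces equal lengths. *)
Lemma same_action_later u v : occurs_later u -> occurs_later v ->
  same_action u v -> u = v.
Proof.
wlog le_uv : u v / size u <= size v => [wlg|] lu lv uv.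
  have [|/ltnW] := leqP (size u) (size v); first by move/wlg; apply.
  by move/wlg => e; apply/esym/e => // q qw; rewrite uv.
have [q qw [ev _]] := occurs_laterE lv; have := uv q qw; rewrite ev => eu.
have quv : suffix (q ++ v) (q ++ u) by rewrite -eu suffix_meet_suffix.
have := size_suffix quv; rewrite !size_cat leq_add2l => le_vu.
have e : size v = size u by apply/eqP; rewrite eqn_leq le_vu.
by move: quv; rewrite suffix_catl // => /andP[/eqP].
Qed.

Lemma reset_prefixE u : u != [::] ->
  reset_word (prefix_automaton w) u <-> ~ occurs_later u.
Proof.
move=> u0; split=> [ru /occurs_later_moves[q qw]|nu q q'].
  have := ru (exist _ q qw) (exist _ [::] (prefix0s w)).
  by move/(congr1 (@sval _ _)); rewrite !sval_run /= => e /(_ e).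
by apply: eq_sig_hprop => [x p p'|]; [exact: eq_irrelevance|rewrite !sval_run !suffix_meet_later].
Qed.

Lemma Pref_synE : Pref_syn w = Pref w.
Proof.
rewrite predeqE => u; split=> [[uw up ru]|[u0 uw up nsu nFu]].
  have u0 : u != [::].
    (* The empty word fixes every state, so it resets only if [[::] = w], which [u != w]
       excludes. *)
    apply: contra_neq uw => u0; have := ru (exist _ [::] (prefix0s w)) (initial _).
    move/(congr1 (@sval _ _)).
    by rewrite !sval_run u0 !cats0 !suffix_meet_id
      ?prefix0s ?prefix_refl.
  have := ru; rewrite reset_prefixE // -Fact_Suff_later => nu.
  have nFu : ~ inner_factor u w by move=> Fu; apply: nu; left.
  by split=> // su; apply: nu; right.
split=> //; apply/reset_prefixE => //.
by rewrite -Fact_Suff_later => -[//|[_ _]].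
Qed.

(** * Constant actions and the syntactic congruence *)

Section NonFirstLetter.
Variable b : Sigma.
Hypothesis nbw : forall t, ~~ prefix (b :: t) w.

(** A block of length |w| + 1 erases any state, and makes the word too long to lie in [w] and
    nonempty even for empty [q] and [w]. *)
Definition constant_word q := nseq (size w).+1 b ++ q.

Lemma suffix_meet_constant x q : prefix q w ->
  suffix_meet (x ++ constant_word q) w = q.
Proof.
move=> qw; rewrite /constant_word catA -suffix_meet_catl.
suff -> : suffix_meet (x ++ nseq (size w).+1 b) w = [::] by rewrite suffix_meet_id.
apply: suffix_meetP; rewrite ?suffix0s ?prefix0s // => t txb tw.
(* [t] is no longer than [w], hence lies within the block of [b]. *)
rewrite (prefix_suffix_nseq nbw tw (n := (size w).+1)) //.
apply: suffix_leq_size txb (suffix_suffix _ _) _.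
by rewrite size_nseq; apply: leqW; exact: size_prefix.
Qed.

Lemma constant_word_not_later q : ~ occurs_later (constant_word q).
Proof. by move/occurs_later_size; rewrite size_cat size_nseq; lia. Qed.

(** To separate actions that differ at [q], a constant word leads to [q], and [r] completes the
    longer value to [w]. The shorter value followed by [r] is too short to yield [w] unless the
    lengths agree, and prefixes of [w] of equal length coincide. *)
Lemma syntactic_congruenceE u v :
  syntactic_congruence (left_quotient w (left_ideal_of w)) u v <->
  same_action u v.
Proof.
split=> [uv q qw|uv x y]; last first.
  rewrite !left_quotientE !catA -suffix_meet_catl -(suffix_meet_catl (_ ++ v)).
  rewrite -(suffix_meet_catl (w ++ x) u) -(suffix_meet_catl (w ++ x) v).
  by rewrite uv ?suffix_meet_prefix.
wlog le_vu : u v uv / size (suffix_meet (q ++ v) w) <= size (suffix_meet (q ++ u) w).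
  move=> wlg; case/orP: (leq_total (size (suffix_meet (q ++ v) w))
    (size (suffix_meet (q ++ u) w))) => [/wlg|/wlg e]; first exact.
  by apply/esym/e => x y; rewrite uv.
apply: (prefix_eq_size (suffix_meet_prefix _ _) (suffix_meet_prefix _ _)).
have pw := suffix_meet_prefix (q ++ u) w; case/prefixP: (pw) => r ew.
have act z : suffix_meet (w ++ constant_word q ++ z ++ r) w
           = suffix_meet (suffix_meet (q ++ z) w ++ r) w.
  by rewrite catA -suffix_meet_catl suffix_meet_constant // catA suffix_meet_catl.
have := (uv (constant_word q) r).1; rewrite !left_quotientE !act -ew.
rewrite suffix_meet_id ?prefix_refl // => /(_ erefl) /(congr1 size) e.
have := size_suffix_meet (suffix_meet (q ++ v) w ++ r) w.
by rewrite e {1}ew !size_cat leq_add2r => le_uv; apply/eqP; rewrite eqn_leq le_uv.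
Qed.

(** * Counting the classes through representatives *)

Definition representatives : set (seq Sigma) :=
  [set constant_word q | q in [set q | prefix q w]] `|` (Fact w `|` Suff w).

Lemma finite_prefix : finite_set [set q | prefix q w].
Proof. by apply: sub_finite_set (finite_infix w) => q /prefixW. Qed.

Lemma finite_Fact : finite_set (Fact w).
Proof.
apply: sub_finite_set (finite_infix w) => u [_ [x [y [_ _ ->]]]].
exact: infix_infix.
Qed.

Lemma finite_Suff : finite_set (Suff w).
Proof. by apply: sub_finite_set (finite_infix w) => u [_ _ /suffixW]. Qed.

Lemma finite_representatives : finite_set representatives.
Proof.
rewrite !finite_setU; split; first exact/finite_image/finite_prefix.
by split; [exact: finite_Fact|exact: finite_Suff].
Qed.

Lemma card_prefix : ([set q | prefix q w] #= `I_(size w).+1)%card.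
Proof.
have -> : [set q | prefix q w] = [set take i w | i in `I_(size w).+1].
  rewrite predeqE => q; split=> [qw|[i _ <-]]; last exact: prefix_take.
  by exists (size q); [exact: size_prefix|apply/eqP; rewrite -prefixE].
apply: inj_card_eq => i j; rewrite !inE /= => lei lej /(congr1 size).
by rewrite !size_take_min; lia.
Qed.

Lemma card_representatives : card_words representatives =
  size w + 1 + card_words (Fact w) + card_words (Suff w).
Proof.
have finF := finite_Fact; have finS := finite_Suff.
rewrite card_wordsU ?finite_setU //; last 2 first.
- exact/finite_image/finite_prefix.
- by move=> _ [q _ <-]; rewrite Fact_Suff_later; exact: constant_word_not_later.
rewrite card_wordsU //; last by move=> u Fu [].
rewrite addnA; congr (_ + _ + _); apply: card_fset_set; rewrite addn1.
(* [constant_word] is injective, as all its values begin with the same block. *)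
apply: card_eq_trans card_prefix; apply: inj_card_eq => q q' _ _ /eqP.
by rewrite eqseq_cat // => /andP[_ /eqP].
Qed.

(** Values at the empty prefix separate the constant words, and [occurs_later_moves] shows that a
    word occurring later is not constant. *)
Lemma same_action_inj u v : representatives u -> representatives v ->
  same_action u v -> u = v.
Proof.
have later_const t q : occurs_later t -> ~ same_action t (constant_word q).
  move=> /occurs_later_moves[p pw ne] act; apply: ne.
  have := act [::] (prefix0s _); rewrite (act p pw) /= => ->.
  rewrite suffix_meet_later //; exact: constant_word_not_later.
rewrite /representatives Fact_Suff_later.
move=> [[q /= qw <-]|lu] [[q' /= q'w <-]|lv] uv.
- by have := uv _ (prefix0s _); rewrite !suffix_meet_constant // => ->.
- by case: (later_const _ q lv) => p pw; rewrite uv.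
- by case: (later_const _ q' lu).
- exact: same_action_later.
Qed.

Lemma representative_exists u : u != [::] ->
  exists2 v, representatives v & same_action u v.
Proof.
move=> u0; rewrite /representatives Fact_Suff_later.
have [lu|nu] := pselect (occurs_later u); first by exists u => //; right.
have mw := suffix_meet_prefix u w; exists (constant_word (suffix_meet u w)).
  by left; exists (suffix_meet u w).
by move=> q qw; rewrite suffix_meet_constant // suffix_meet_later.
Qed.

Lemma representatives_neq0 u : representatives u -> u != [::].
Proof. by rewrite /representatives Fact_Suff_later => -[[q _ <-]|[]]. Qed.

Lemma card_syntactic_semigroup :
  (syntactic_semigroup (left_quotient w (left_ideal_of w)) #= representatives)%card.
Proof.
pose cls u := [set v | v != [::] /\
  syntactic_congruence (left_quotient w (left_ideal_of w)) u v].
have -> : syntactic_semigroup (left_quotient w (left_ideal_of w))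
        = cls @` representatives.
  rewrite predeqE => C; split=> [[u /= u0 <-]|[u /representatives_neq0 u0 <-]].
    have [v rv uv] := representative_exists u0; exists v => //.
    rewrite predeqE => t; split=> -[t0 /syntactic_congruenceE vt]; split=> //;
      apply/syntactic_congruenceE => q qw; first by rewrite uv // vt.
    by rewrite -uv // vt.
  by exists u.
apply: inj_card_eq => u v; rewrite !inE => ru rv.
(* [v] lies in its own class, hence in the class of [u]. *)
rewrite predeqE => /(_ v)[_] [|_ /syntactic_congruenceE uv].
  by split; [exact: representatives_neq0|].
exact: same_action_inj.
Qed.

End NonFirstLetter.
End SuffixMeet.

Theorem proposition3 (Sigma : finType) (hSigma : 1 < #|Sigma|) (w : seq Sigma) :
  has_syntactic_complexity (left_quotient w (left_ideal_of w))
    (size w + 1 + card_words (Pref w) + card_words (Fact w)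
       + card_words (Suff w) - card_words (Pref_syn w)).
Proof.
have [b nbw] := exists_non_first_letter w hSigma.
apply: card_eq_trans (card_syntactic_semigroup nbw) _.
(* Once [Pref_syn w] is replaced by [Pref w], the truncated subtraction cancels exactly. *)
rewrite Pref_synE (_ : _ - _ = card_words (representatives w b)).
  exact/card_eq_words/finite_representatives.
by rewrite card_representatives; lia.
Qed.
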